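(* Let $k\ge1$ be an integer and let $P\in\mathbb{R}$ satisfy $P>k^2$. Let $\alpha,\beta\in\mathbb{R}$ and let $\Theta_k$ be the solution of $$\ddot{\Theta}_k(t)+k^2(k^2-P)\Theta_k(t)+k^4\Theta_k(t)^3=0,\qquad \Theta_k(0)=\alpha,\quad \dot\Theta_k(0)=\beta .$$ Assume that its energy $E=E(\alpha,\beta)$ satisfies $$\text{either}\qquad -\frac{(P-k^2)^2}{4}<E<0\qquad\text{or}\qquad E>0 .$$ Then $\Theta_k$ is periodic and its period $T(E)$ is given by $$T(E)=\frac{4\sqrt2}{k^2}\int_0^1\frac{d\theta}{\sqrt{(\Lambda_2(E)+\Lambda_1(E)\theta^2)(1-\theta^2)}}\qquad\text{if }E>0,$$ and by $$T(E)=\frac{2\sqrt{2}}{k\sqrt{P-k^2+\sqrt{(P-k^2)^2+4E}}}\int_\delta^1\frac{d\theta}{\sqrt{(1-\theta^2)(\theta^2-\delta^2)}}\qquad\text{if }E<0,$$ where $\delta=\dfrac{P-k^2-\sqrt{(P-k^2)^2+4E}}{2\sqrt{|E|}}\in(0,1)$. In particular, $$\lim_{E\downarrow-\frac{(P-k^2)^2}{4}}T(E)=\frac{\pi\sqrt2}{k\sqrt{P-k^2}},\qquad \lim_{E\to0}T(E)=+\infty,\qquad \lim_{E\to+\infty}T(E)=0 .$$ Moreover, the map $E\mapsto T(E)$ is strictly increasing on $\left(-\frac{(P-k^2)^2}{4},0\right)$ and strictly decreasing on $(0,+\infty)$.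
   Context: The energy is the quantity (constant along solutions) $$E(\alpha,\beta)=\frac{\dot\Theta_k^2}{2}+\frac{k^2(k^2-P)}{2}\Theta_k^2+\frac{k^4}{4}\Theta_k^4\equiv\frac{\beta^2}{2}+\frac{k^2(k^2-P)}{2}\alpha^2+\frac{k^4}{4}\alpha^4 .$$ For $E>0$ put $$\Lambda_1(E):=\frac{\sqrt{(k^2-P)^2+4E}+P-k^2}{k^2}>0,\qquad \Lambda_2(E):=\frac{\sqrt{(k^2-P)^2+4E}-P+k^2}{k^2}>0 .$$ The period means the smallest positive period. *)

(* Defs.v *)
(* Stdlib reals with Coquelicot. *)
From Stdlib Require Import Reals.
From Coquelicot Require Import Coquelicot.
Open Scope R_scope.

(* [ex_derive] is required at both orders because [Derive] is total: the
   equation alone would say nothing about a non-differentiable [Theta]. *)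
Definition is_solution (k : nat) (P alpha beta : R) (Theta : R -> R) : Prop :=
  (forall t, ex_derive Theta t) /\
  (forall t, ex_derive (Derive Theta) t) /\
  (forall t, Derive (Derive Theta) t
             + INR k ^ 2 * (INR k ^ 2 - P) * Theta t
             + INR k ^ 4 * Theta t ^ 3 = 0) /\
  Theta 0 = alpha /\
  Derive Theta 0 = beta.

Definition energy (k : nat) (P alpha beta : R) : R :=
  beta ^ 2 / 2 + INR k ^ 2 * (INR k ^ 2 - P) / 2 * alpha ^ 2
  + INR k ^ 4 / 4 * alpha ^ 4.

Definition Lambda1 (k : nat) (P E : R) : R :=
  (sqrt ((INR k ^ 2 - P) ^ 2 + 4 * E) + P - INR k ^ 2) / INR k ^ 2.

Definition Lambda2 (k : nat) (P E : R) : R :=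
  (sqrt ((INR k ^ 2 - P) ^ 2 + 4 * E) - P + INR k ^ 2) / INR k ^ 2.

Definition delta (k : nat) (P E : R) : R :=
  (P - INR k ^ 2 - sqrt ((P - INR k ^ 2) ^ 2 + 4 * E)) / (2 * sqrt (Rabs E)).

Definition is_period (f : R -> R) (tau : R) : Prop :=
  forall t, f (t + tau) = f t.

Definition is_smallest_period (f : R -> R) (tau : R) : Prop :=
  0 < tau /\ is_period f tau /\
  (forall sigma, 0 < sigma -> is_period f sigma -> tau <= sigma).

Definition integrand_pos (k : nat) (P E theta : R) : R :=
  1 / sqrt ((Lambda2 k P E + Lambda1 k P E * theta ^ 2) * (1 - theta ^ 2)).

Definition integrand_neg (k : nat) (P E theta : R) : R :=
  1 / sqrt ((1 - theta ^ 2) * (theta ^ 2 - delta k P E ^ 2)).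

(* Main.v *)
Require Import Defs.
From Stdlib Require Import Reals Lra.
From Coquelicot Require Import Coquelicot.
Open Scope R_scope.

(* Write m = P - k^2 and D = sqrt (m^2 + 4E). Both kinds of orbits are
   parametrised by an angle phi solving the first-order equation
     phi' = k / sqrt 2 * sqrt (A + B cos^2 phi):
   for E > 0, Theta = sqrt B / k * cos phi with (A, B) = (D - m, D + m), and
   for E < 0, Theta = sqrt (A + B cos^2 phi) / k up to sign, with
   (A, B) = (m - D, 2D). Every solution is one of these up to a time shift, by
   uniqueness. If J(A, B) is the integral over [0, PI] of
   1 / sqrt (A + B cos^2), the smallest period is therefore
   2 sqrt 2 / k * J(D - m, D + m), resp. sqrt 2 / k * J(m - D, 2D). The
   substitutions x = cos phi, resp. x^2 = (A + B cos^2 phi) / (A + B), give the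
   elliptic integrals. Limits and monotonicity are read off J; for E < 0, folding
   phi with PI/2 - phi makes the integrand
     1 / sqrt (m + D cos 2phi) + 1 / sqrt (m - D cos 2phi),
   which increases with D. *)

(** * Inverting the time integral of a scalar flow *)

Lemma ex_RInt_cont (f : R -> R) (hf : forall x, continuous f x) (a b : R) :
  ex_RInt f a b.
Proof. apply (ex_RInt_continuous (V := R_CompleteNormedModule)); auto. Qed.

Lemma is_derive_RInt_cont (f : R -> R) (hf : forall x, continuous f x) (a x : R) :
  is_derive (fun y => RInt f a y) x (f x).
Proof.
  apply (is_derive_RInt f _ a); [|apply hf].
  apply filter_forall; intros y.
  apply (RInt_correct f), ex_RInt_cont, hf.
Qed.

Lemma RInt_Chasles_cont (f : R -> R) (hf : forall x, continuous f x) (a b c : R) :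
  RInt f a c = RInt f a b + RInt f b c.
Proof.
  symmetry; apply (RInt_Chasles f); apply ex_RInt_cont, hf.
Qed.

Lemma RInt_shift (f : R -> R) (hf : forall x, continuous f x) (p a b : R) :
  RInt (fun x => f (x + p)) a b = RInt f (a + p) (b + p).
Proof.
  pose proof (RInt_comp_lin f 1 p a b) as H.
  rewrite !Rmult_1_l in H.
  rewrite <- H by apply ex_RInt_cont, hf.
  apply RInt_ext; intros x _.
  unfold scal; simpl; unfold mult; simpl; now rewrite !Rmult_1_l.
Qed.

Lemma RInt_reflect (f : R -> R) (hf : forall x, continuous f x) (p a b : R) :
  RInt (fun x => f (p - x)) a b = RInt f (p - b) (p - a).
Proof.
  pose proof (RInt_comp_lin f (-1) p a b (ex_RInt_cont f hf _ _)) as H.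
  replace (-1 * a + p) with (p - a) in H by ring.
  replace (-1 * b + p) with (p - b) in H by ring.
  rewrite <- (opp_RInt_swap f) by apply ex_RInt_cont, hf.
  rewrite <- H.
  rewrite <- (RInt_opp (V := R_CompleteNormedModule)).
  - apply RInt_ext; intros x _; unfold scal, opp; simpl; unfold mult; simpl.
    replace (-1 * x + p) with (p - x) by ring. ring.
  - apply ex_RInt_cont; intros x.
    apply (continuous_scal_r (V := R_NormedModule)).
    apply (continuous_comp (fun y => -1 * y + p) f); [|apply hf].
    apply (ex_derive_continuous (fun y => -1 * y + p)); auto_derive; trivial.
Qed.

(** [Phi] is the inverse of the travel time [G x], the integral of [1 / h] from 0 to [x]. The upper
    bound [M] on the speed gives [G' >= 1 / M], so [G] maps onto the whole line and the flow is
    global. Both inverse relations are kept because they turn statements about time into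
    integrals. *)
Lemma flow_exists (h : R -> R) (M : R)
  (hc : forall x, continuous h x) (h0 : forall x, 0 < h x <= M) :
  exists Phi : R -> R,
    (forall t, is_derive Phi t (h (Phi t))) /\
    (forall x, Phi (RInt (fun u => / h u) 0 x) = x) /\
    (forall t, RInt (fun u => / h u) 0 (Phi t) = t).
Proof.
  set (G := fun x => RInt (fun u => / h u) 0 x).
  assert (hM : 0 < M) by (destruct (h0 0); lra).
  assert (ic : forall x, continuous (fun u => / h u) x).
  { intros x; apply continuous_comp; [apply hc|].
    apply (ex_derive_continuous Rinv); auto_derive.
    destruct (h0 x); lra. }
  assert (dG : forall x, is_derive G x (/ h x)).
  { intros x; apply (is_derive_RInt_cont (fun u => / h u) ic). }
  assert (cG : forall x, continuity_pt G x).
  { intros x; apply continuity_pt_filterlim.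
    apply (ex_derive_continuous G); eexists; apply dG. }
  (* Solved for [y - x], the mean value theorem serves three times: for the growth of [G], for the
     Lipschitz bound on [Phi] and for the injectivity of [G]. *)
  assert (mvt : forall x y, exists c,
             Rmin x y <= c <= Rmax x y /\ y - x = h c * (G y - G x)).
  { intros x y.
    destruct (MVT_gen G x y (fun u => / h u)) as [c [hc1 hc2]]; auto.
    exists c; split; [exact hc1|]. rewrite hc2.
    destruct (h0 c). field; lra. }
  assert (G0 : G 0 = 0) by (unfold G; apply (RInt_point (V := R_CompleteNormedModule))).
  assert (surj : forall t, {x | G x = t}).
  { intros t.
    (* Over a distance [M * Rabs t] the travel time changes by at least [Rabs t], so these endpoints
       bracket [t]. *)
    destruct (IVT_gen G (- (M * Rabs t)) (M * Rabs t) t) as [x [_ hx]].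
    - intros x; apply cG.
    - assert (0 <= Rabs t) by apply Rabs_pos.
      assert (hMt : 0 <= M * Rabs t) by nra.
      destruct (mvt 0 (M * Rabs t)) as [c1 [_ e1]].
      destruct (mvt 0 (- (M * Rabs t))) as [c2 [_ e2]].
      destruct (h0 c1), (h0 c2). rewrite G0 in e1, e2.
      assert (t <= Rabs t) by apply RRle_abs.
      assert (- t <= Rabs t) by (rewrite <- Rabs_Ropp; apply RRle_abs).
      assert (Rabs t <= G (M * Rabs t)).
      { apply Rmult_le_reg_l with M; [lra|]. nra. }
      assert (G (- (M * Rabs t)) <= - Rabs t).
      { apply Rmult_le_reg_l with M; [lra|]. nra. }
      split.
      + eapply Rle_trans; [apply Rmin_l|lra].
      + eapply Rle_trans; [|apply Rmax_r]; lra.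
    - exists x; exact hx. }
  set (Phi := fun t => proj1_sig (surj t)).
  assert (GP : forall t, G (Phi t) = t) by (intros t; apply (proj2_sig (surj t))).
  exists Phi; split; [|split; [|exact GP]].
  - intros t; apply is_derive_Reals; intros eps he.
    destruct (proj1 (filterlim_locally h (h (Phi t))) (hc (Phi t)) (mkposreal eps he))
      as [d hd].
    (* The difference quotient of [Phi] equals [h c] with [c] between [Phi t] and [Phi (t + s)]. As
       [Phi] is [M]-Lipschitz, [Rabs s < d / M] keeps [c] within [d] of [Phi t], where continuity of
       [h] applies. *)
    assert (hdM : 0 < d / M) by (apply Rdiv_lt_0_compat; [apply cond_pos|lra]).
    exists (mkposreal _ hdM); simpl; intros s hs0 hs.
    destruct (mvt (Phi t) (Phi (t + s))) as [c [hc1 hc2]].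
    rewrite !GP in hc2.
    replace (t + s - t) with s in hc2 by ring.
    rewrite hc2. replace (h c * s / s) with (h c) by (field; exact hs0).
    apply (hd c).
    assert (b1 : Rabs (Phi (t + s) - Phi t) < d).
    { rewrite hc2, Rabs_mult. destruct (h0 c).
      rewrite (Rabs_right (h c)) by lra.
      apply Rle_lt_trans with (M * Rabs s).
      - apply Rmult_le_compat_r; [apply Rabs_pos|lra].
      - apply Rlt_le_trans with (M * (d / M)); [apply Rmult_lt_compat_l; lra|].
        right; field; lra. }
    change (Rabs (c - Phi t) < d).
    revert hc1 b1; unfold Rmin, Rmax; destruct (Rle_dec (Phi t) (Phi (t + s)));
      intros hc1; unfold Rabs at 1; destruct Rcase_abs; intros;
      unfold Rabs; destruct Rcase_abs; lra.
  - intros x. change (Phi (G x) = x).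
    destruct (mvt x (Phi (G x))) as [c [_ e]].
    rewrite GP in e. lra.
Qed.

Lemma increasing_of_flow (h Phi : R -> R) (h0 : forall x, 0 < h x)
  (dP : forall t, is_derive Phi t (h (Phi t))) (s t : R) (hst : s < t) :
  Phi s < Phi t.
Proof.
  apply (incr_function Phi m_infty p_infty (fun u => h (Phi u)));
    simpl; auto.
  intros; apply h0.
Qed.

Lemma exists_angle (c s : R) (hcs : c ^ 2 + s ^ 2 = 1) :
  exists x, cos x = c /\ sin x = s.
Proof.
  assert (hc : -1 <= c <= 1) by nra.
  assert (hs : sin (acos c) = Rabs s).
  { rewrite sin_acos by exact hc.
    replace (1 - Rsqr c) with (Rsqr s) by (unfold Rsqr; lra).
    apply sqrt_Rsqr_abs. }
  destruct (Rle_dec 0 s) as [h|h].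
  - exists (acos c); split; [now apply cos_acos|].
    now rewrite hs, Rabs_right by lra.
  - exists (- acos c); split; [rewrite cos_neg; now apply cos_acos|].
    rewrite sin_neg, hs, Rabs_left by lra. ring.
Qed.

Lemma pos_zero_sin (x : R) (hx : 0 < x) (h : sin x = 0) : PI <= x.
Proof.
  destruct (Rle_lt_dec PI x) as [|l]; [assumption|].
  pose proof (sin_gt_0 x hx l); lra.
Qed.

(** By [1 - cos x = 2 sin^2 (x / 2)], the half angle is a positive zero of [sin]. *)
Lemma pos_cos_eq_1 (x : R) (hx : 0 < x) (h : cos x = 1) : 2 * PI <= x.
Proof.
  replace x with (2 * (x / 2)) in h by field.
  rewrite cos_2a_sin in h.
  assert (PI <= x / 2); [|lra].
  apply pos_zero_sin; nra.
Qed.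

(** * The Duffing equation *)

(** The weight [exp (- L t)] makes [w] nonincreasing after [t0], and [exp (L t)] makes it
    nondecreasing before [t0]. Since [w] is nonnegative and vanishes at [t0], it vanishes on both
    sides. *)
Lemma gronwall_zero (w dw : R -> R) (L t0 : R)
  (hd : forall t, is_derive w t (dw t)) (hw : forall t, 0 <= w t)
  (hL : forall t, Rabs (dw t) <= L * w t) (h0 : w t0 = 0) (t : R) : w t = 0.
Proof.
  apply Rle_antisym; [|apply hw].
  assert (mvt : forall s, exists c, Rmin t0 t <= c <= Rmax t0 t /\
             w t * exp (s * t) = (dw c + s * w c) * exp (s * c) * (t - t0)).
  { intros s.
    assert (D : forall x, is_derive (fun x => w x * exp (s * x)) x
                       ((dw x + s * w x) * exp (s * x))).
    { intros x. pose proof (hd x) as hx. auto_derive.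
      - repeat split; eexists; eassumption.
      - rewrite (is_derive_unique (fun x0 : R => w x0) x _ hx). ring. }
    destruct (MVT_gen (fun x => w x * exp (s * x)) t0 t
                (fun x => (dw x + s * w x) * exp (s * x))) as [c [hc e]].
    - intros; apply D.
    - intros x _; apply continuity_pt_filterlim.
      apply (ex_derive_continuous (fun x => w x * exp (s * x))); eexists; apply D.
    - exists c; split; [exact hc|].
      cbv beta in e. rewrite h0 in e. lra. }
  destruct (Rle_dec t0 t) as [h|h].
  - destruct (mvt (- L)) as [c [_ e]].
    pose proof (exp_pos (- L * t)). pose proof (exp_pos (- L * c)).
    pose proof (hL c). pose proof (RRle_abs (dw c)).
    assert (0 <= (L * w c - dw c) * exp (- L * c) * (t - t0)) by
      (apply Rmult_le_pos; [apply Rmult_le_pos|]; lra).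
    assert (w t * exp (- L * t) <= 0) by nra.
    nra.
  - destruct (mvt L) as [c [_ e]].
    pose proof (exp_pos (L * t)). pose proof (exp_pos (L * c)).
    pose proof (hL c). pose proof (RRle_abs (- dw c)) as hm.
    rewrite Rabs_Ropp in hm.
    assert (0 <= (L * w c + dw c) * exp (L * c) * (t0 - t)) by
      (apply Rmult_le_pos; [apply Rmult_le_pos|]; lra).
    assert (w t * exp (L * t) <= 0) by nra.
    nra.
Qed.

(** First-order form of [u'' = a u - b u^3], with the velocity as separate data so that explicit
    orbits can be checked componentwise. It is applied with [a = k^2 (P - k^2)] and [b = k^4]. *)
Definition duffing (a b : R) (u du : R -> R) : Prop :=
  (forall t, is_derive u t (du t)) /\
  (forall t, is_derive du t (a * u t - b * u t ^ 3)).

Lemma duffing_energy (a b : R) (u du : R -> R) (hu : duffing a b u du) (s t : R) :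
  du s ^ 2 / 2 - a / 2 * u s ^ 2 + b / 4 * u s ^ 4
  = du t ^ 2 / 2 - a / 2 * u t ^ 2 + b / 4 * u t ^ 4.
Proof.
  destruct hu as [h1 h2].
  assert (D : forall x, is_derive (fun x => du x ^ 2 / 2 - a / 2 * u x ^ 2 + b / 4 * u x ^ 4)
                     x zero).
  { intros x. pose proof (h1 x) as e1; pose proof (h2 x) as e2. auto_derive.
    - repeat split; eexists; eassumption.
    - rewrite (is_derive_unique (fun x0 : R => u x0) x _ e1).
      rewrite (is_derive_unique (fun x0 : R => du x0) x _ e2).
      unfold zero; simpl. field. }
  destruct (Rtotal_order s t) as [h|[h|h]].
  - apply (eq_is_derive _ s t (fun x _ => D x) h).
  - now rewrite h.
  - symmetry; apply (eq_is_derive _ t s (fun x _ => D x) h).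
Qed.

(** The quartic term dominates the conserved energy [e]. With [X = u^2], [b X^2 <= 4 |e| + 2 |a| X],
    and for [X > 1] one factor [X] cancels. *)
Lemma duffing_bounded (a b : R) (u du : R -> R) (hb : 0 < b) (hu : duffing a b u du) :
  exists K, forall t, u t ^ 2 <= K.
Proof.
  set (e := du 0 ^ 2 / 2 - a / 2 * u 0 ^ 2 + b / 4 * u 0 ^ 4).
  exists (1 + (4 * Rabs e + 2 * Rabs a) / b); intros t.
  assert (he : du t ^ 2 / 2 - a / 2 * u t ^ 2 + b / 4 * u t ^ 4 = e)
    by apply duffing_energy, hu.
  replace (u t ^ 4) with (u t ^ 2 * u t ^ 2) in he by ring.
  pose proof (RRle_abs e). pose proof (RRle_abs a).
  pose proof (Rabs_pos e). pose proof (Rabs_pos a).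
  pose proof (pow2_ge_0 (u t)). pose proof (pow2_ge_0 (du t)).
  set (X := u t ^ 2) in *.
  assert (0 <= (4 * Rabs e + 2 * Rabs a) / b)
    by (apply Rmult_le_pos; [lra|left; now apply Rinv_0_lt_compat]).
  destruct (Rle_dec X 1) as [h|h]; [lra|].
  apply Rle_trans with ((4 * Rabs e + 2 * Rabs a) / b); [|lra].
  apply (Rmult_le_reg_r b); [assumption|].
  replace ((4 * Rabs e + 2 * Rabs a) / b * b) with (4 * Rabs e + 2 * Rabs a) by (field; lra).
  apply (Rmult_le_reg_r X); [lra|]. nra.
Qed.

(** The cubic is Lipschitz only on bounded sets, which suffices because energy bounds both
    solutions. Gronwall is then applied to their squared distance [w] in the phase plane. *)
Lemma duffing_unique (a b : R) (u du v dv : R -> R) (hb : 0 < b)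
  (hu : duffing a b u du) (hv : duffing a b v dv) (t0 : R)
  (e0 : u t0 = v t0) (e1 : du t0 = dv t0) (t : R) : u t = v t.
Proof.
  destruct (duffing_bounded a b u du hb hu) as [K1 hK1].
  destruct (duffing_bounded a b v dv hb hv) as [K2 hK2].
  destruct hu as [u1 u2], hv as [v1 v2].
  set (w := fun t => (u t - v t) ^ 2 + (du t - dv t) ^ 2).
  (* Factoring [u^3 - v^3] gives [w' = 2 (u - v) (du - dv) q], whose first factors are bounded by
     [w] and whose last is bounded by a constant. *)
  set (q := fun t => 1 + a - b * (u t ^ 2 + u t * v t + v t ^ 2)).
  assert (hw : w t = 0).
  { apply (gronwall_zero w (fun t => 2 * (u t - v t) * (du t - dv t) * q t)
             (1 + Rabs a + 2 * b * (K1 + K2)) t0).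
    - intros x; unfold w, q.
      pose proof (u1 x) as a1; pose proof (u2 x) as a2.
      pose proof (v1 x) as a3; pose proof (v2 x) as a4. auto_derive.
      + repeat split; eexists; eassumption.
      + rewrite (is_derive_unique (fun x0 : R => u x0) x _ a1).
        rewrite (is_derive_unique (fun x0 : R => du x0) x _ a2).
        rewrite (is_derive_unique (fun x0 : R => v x0) x _ a3).
        rewrite (is_derive_unique (fun x0 : R => dv x0) x _ a4). ring.
    - intros x; unfold w. apply Rplus_le_le_0_compat; apply pow2_ge_0.
    - intros x. rewrite Rabs_mult.
      assert (B1 : Rabs (2 * (u x - v x) * (du x - dv x)) <= w x).
      { unfold w; pose proof (pow2_ge_0 (u x - v x - (du x - dv x))).
        pose proof (pow2_ge_0 (u x - v x + (du x - dv x))).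
        apply Rabs_le; split; lra. }
      assert (B2 : Rabs (q x) <= 1 + Rabs a + 2 * b * (K1 + K2)).
      { unfold q. pose proof (hK1 x); pose proof (hK2 x).
        pose proof (RRle_abs a). pose proof (RRle_abs (- a)) as ha.
        rewrite Rabs_Ropp in ha.
        pose proof (pow2_ge_0 (u x - v x)). pose proof (pow2_ge_0 (u x + v x)).
        pose proof (pow2_ge_0 (u x)). pose proof (pow2_ge_0 (v x)).
        assert (0 <= u x ^ 2 + u x * v x + v x ^ 2 <= 2 * (K1 + K2)) by (split; lra).
        assert (0 <= b * (u x ^ 2 + u x * v x + v x ^ 2) <= b * (2 * (K1 + K2)))
          by (split; [apply Rmult_le_pos|apply Rmult_le_compat_l]; lra).
        apply Rabs_le; split; lra. }
      rewrite Rmult_comm. apply Rmult_le_compat; auto using Rabs_pos.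
    - unfold w. rewrite e0, e1. ring. }
  unfold w in hw.
  pose proof (pow2_ge_0 (u t - v t)). pose proof (pow2_ge_0 (du t - dv t)).
  assert (e : (u t - v t) ^ 2 = 0) by lra.
  apply Rminus_diag_uniq. apply (Rsqr_0_uniq (u t - v t)). unfold Rsqr; lra.
Qed.

Lemma sqrt_sq (x : R) (hx : 0 <= x) : sqrt x ^ 2 = x.
Proof. rewrite <- Rsqr_pow2. now apply Rsqr_sqrt. Qed.

Lemma duffing_shift (a b s : R) (u du : R -> R) (hu : duffing a b u du) :
  duffing a b (fun t => u (t + s)) (fun t => du (t + s)).
Proof.
  destruct hu as [h1 h2]; split; intros t.
  - pose proof (h1 (t + s)) as e. auto_derive; [eexists; exact e|].
    rewrite (is_derive_unique (fun x : R => u x) _ _ e); ring.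
  - pose proof (h2 (t + s)) as e. auto_derive; [eexists; exact e|].
    rewrite (is_derive_unique (fun x : R => du x) _ _ e); ring.
Qed.

Lemma duffing_opp (a b : R) (u du : R -> R) (hu : duffing a b u du) :
  duffing a b (fun t => - u t) (fun t => - du t).
Proof.
  destruct hu as [h1 h2]; split; intros t.
  - apply (is_derive_opp u), h1.
  - replace (a * - u t - b * (- u t) ^ 3) with (- (a * u t - b * u t ^ 3)) by ring.
    apply (is_derive_opp du), h2.
Qed.

Lemma smallest_period_shift (f g : R -> R) (s tau : R)
  (hg : forall t, g t = f (t + s)) (hf : is_smallest_period f tau) :
  is_smallest_period g tau.
Proof.
  destruct hf as [h0 [h1 h2]]; split; [exact h0|split].
  - intros t. rewrite !hg, <- (h1 (t + s)). f_equal; ring.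
  - intros sigma hs hp. apply h2; [exact hs|].
    intros t. specialize (hp (t - s)). rewrite !hg in hp.
    replace (t - s + s) with t in hp by ring.
    rewrite <- hp. f_equal; ring.
Qed.

Lemma smallest_period_opp (f g : R -> R) (tau : R)
  (hg : forall t, g t = - f t) (hf : is_smallest_period f tau) :
  is_smallest_period g tau.
Proof.
  destruct hf as [h0 [h1 h2]]; split; [exact h0|split].
  - intros t. now rewrite !hg, h1.
  - intros sigma hs hp. apply h2; [exact hs|].
    intros t. specialize (hp t). rewrite !hg in hp. lra.
Qed.

(** * The complete elliptic integral and the periods *)

Definition kernel (A B x : R) : R := / sqrt (A + B * cos x ^ 2).

(** In Legendre's notation this is [2 K(kappa) / sqrt (A + B)] with [kappa^2 = B / (A + B)], where
    [K] is the complete elliptic integral of the first kind. *)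
Definition half_turn (A B : R) : R := RInt (kernel A B) 0 PI.

Lemma radicand_pos (A B x : R) (hA : 0 < A) (hB : 0 <= B) : 0 < A + B * cos x ^ 2.
Proof. pose proof (pow2_ge_0 (cos x)). nra. Qed.

Lemma radicand_le (A B x : R) (hB : 0 <= B) : A + B * cos x ^ 2 <= A + B.
Proof.
  pose proof (COS_bound x). assert (cos x ^ 2 <= 1) by nra. nra.
Qed.

Lemma kernel_continuous (A B : R) (hA : 0 < A) (hB : 0 <= B) (x : R) :
  continuous (kernel A B) x.
Proof.
  apply (ex_derive_continuous (kernel A B)); unfold kernel; auto_derive.
  pose proof (radicand_pos A B x hA hB). pose proof (sqrt_lt_R0 _ H).
  simpl in *. repeat split; lra.
Qed.

Lemma kernel_pos (A B x : R) (hA : 0 < A) (hB : 0 <= B) : 0 < kernel A B x.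
Proof. apply Rinv_0_lt_compat, sqrt_lt_R0, radicand_pos; assumption. Qed.

Lemma kernel_periodic (A B x : R) : kernel A B (x + PI) = kernel A B x.
Proof. unfold kernel. rewrite neg_cos. do 2 f_equal. ring. Qed.

Lemma kernel_even (A B x : R) : kernel A B (PI - x) = kernel A B x.
Proof.
  unfold kernel. rewrite cos_minus, cos_PI, sin_PI. do 2 f_equal. ring.
Qed.

Lemma half_turn_pos (A B : R) (hA : 0 < A) (hB : 0 <= B) : 0 < half_turn A B.
Proof.
  apply RInt_gt_0; [apply PI_RGT_0| |].
  - intros; now apply kernel_pos.
  - intros; now apply kernel_continuous.
Qed.

Lemma half_turn_quarter (A B : R) (hA : 0 < A) (hB : 0 <= B) :
  half_turn A B = 2 * RInt (kernel A B) 0 (PI / 2).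
Proof.
  unfold half_turn.
  rewrite (RInt_Chasles_cont _ (kernel_continuous A B hA hB) 0 (PI / 2)).
  replace (RInt (kernel A B) (PI / 2) PI) with (RInt (kernel A B) 0 (PI / 2)); [ring|].
  pose proof (RInt_reflect _ (kernel_continuous A B hA hB) PI 0 (PI / 2)) as H.
  replace (PI - PI / 2) with (PI / 2) in H by field.
  rewrite Rminus_0_r in H. rewrite <- H.
  apply RInt_ext; intros; symmetry; apply kernel_even.
Qed.

(** The speed depends on the angle through [cos^2], which has period [PI]. Hence the time needed to
    advance by [PI] is the same from every starting angle. *)
Lemma pendulum_flow (A B c : R) (hA : 0 < A) (hB : 0 <= B) (hc : 0 < c) :
  exists Phi : R -> R,
    (forall t, is_derive Phi t (c * sqrt (A + B * cos (Phi t) ^ 2))) /\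
    (forall s t, s < t -> Phi s < Phi t) /\
    (forall x, exists t, Phi t = x) /\
    Phi 0 = 0 /\
    (forall t, Phi (t + half_turn A B / c) = Phi t + PI).
Proof.
  set (h := fun x => c * sqrt (A + B * cos x ^ 2)).
  assert (hpos : forall x, 0 < h x).
  { intros x; apply Rmult_lt_0_compat; [exact hc|].
    apply sqrt_lt_R0, radicand_pos; assumption. }
  destruct (flow_exists h (c * sqrt (A + B))) as [Phi [d [PG GP]]].
  - intros x; apply (ex_derive_continuous h); unfold h; auto_derive.
    pose proof (radicand_pos A B x hA hB). simpl in *; repeat split; lra.
  - intros x; split; [apply hpos|].
    apply Rmult_le_compat_l; [lra|]. apply sqrt_le_1_alt, radicand_le, hB.
  - assert (kc := kernel_continuous A B hA hB).
    assert (G : forall x, RInt (fun u => / h u) 0 x = / c * RInt (kernel A B) 0 x).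
    { intros x.
      transitivity (scal (/ c) (RInt (kernel A B) 0 x)); [|reflexivity].
      rewrite <- (RInt_scal (kernel A B) 0 x (/ c)) by now apply ex_RInt_cont.
      apply RInt_ext; intros u _. unfold scal; simpl; unfold mult; simpl.
      unfold h, kernel. apply Rinv_mult. }
    exists Phi; split; [exact d|].
    split; [intros s t; exact (increasing_of_flow h Phi hpos d s t)|].
    split; [intros x; eexists; apply PG|].
    split.
    { rewrite <- (PG 0) at 2. f_equal. symmetry.
      apply (RInt_point (V := R_CompleteNormedModule)). }
    (* The travel time to [Phi t + PI] is split at [PI]. The first piece is one half turn, and the
       second, shifted back by [PI], is the travel time to [Phi t]. *)
    intros t. rewrite <- (PG (Phi t + PI)). f_equal.
    rewrite G, (RInt_Chasles_cont _ kc 0 PI), Rmult_plus_distr_l.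
    fold (half_turn A B).
    rewrite <- (Rplus_0_l PI) at 1.
    rewrite <- (RInt_shift _ kc PI 0 (Phi t)).
    rewrite (RInt_ext _ (kernel A B)) by (intros; apply kernel_periodic).
    rewrite <- G, GP. field; lra.
Qed.

Lemma cos2_sin2 (x : R) : cos x ^ 2 + sin x ^ 2 = 1.
Proof. pose proof (sin2_cos2 x). unfold Rsqr in *; lra. Qed.

(** * Explicit orbits and their smallest periods *)

(** Here [D] stands for [sqrt (m^2 + 4E)], and [hE] encodes this without the root. A half turn
    changes the sign of [cos Phi], so the explicit orbit [y] closes up only after two half turns;
    uniqueness transfers its period to [u]. *)
Lemma smallest_period_pos (k m D : R) (u du : R -> R)
  (hk : 0 < k) (hm : 0 < m) (hD : m < D)
  (hu : duffing (k ^ 2 * m) (k ^ 4) u du)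
  (hE : 4 * (du 0 ^ 2 / 2 - k ^ 2 * m / 2 * u 0 ^ 2 + k ^ 4 / 4 * u 0 ^ 4) = D ^ 2 - m ^ 2) :
  is_smallest_period u (2 * (sqrt 2 / k * half_turn (D - m) (D + m))).
Proof.
  set (A := D - m). set (B := D + m).
  assert (hA : 0 < A) by (unfold A; lra). assert (hB : 0 < B) by (unfold B; lra).
  assert (h2 : 0 < sqrt 2) by (apply sqrt_lt_R0; lra).
  assert (e2 : sqrt 2 ^ 2 = 2) by (apply sqrt_sq; lra).
  assert (hsB : 0 < sqrt B) by (now apply sqrt_lt_R0).
  assert (eB : sqrt B ^ 2 = B) by (apply sqrt_sq; lra).
  destruct (pendulum_flow A B (k / sqrt 2)) as [Phi [d [inc [sur [P0 per]]]]];
    [exact hA|lra|now apply Rdiv_lt_0_compat|].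
  set (tau := half_turn A B / (k / sqrt 2)) in *.
  assert (etau : 2 * (sqrt 2 / k * half_turn A B) = 2 * tau) by (unfold tau; field; lra).
  rewrite etau.
  set (y := fun t => sqrt B / k * cos (Phi t)).
  set (dy := fun t => - (sqrt B / sqrt 2 * sin (Phi t) * sqrt (A + B * cos (Phi t) ^ 2))).
  assert (hy : duffing (k ^ 2 * m) (k ^ 4) y dy).
  { split; intros t; pose proof (d t) as dt;
      pose proof (radicand_pos A B (Phi t) hA (Rlt_le _ _ hB)) as hr;
      pose proof (sqrt_lt_R0 _ hr) as hs;
      pose proof (sqrt_sq _ (Rlt_le _ _ hr)) as es.
    - unfold y, dy. auto_derive; [eexists; exact dt|].
      rewrite (is_derive_unique (fun x : R => Phi x) _ _ dt). field; lra.
    - unfold y, dy. auto_derive.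
      + repeat split; try (eexists; exact dt). simpl in hr; lra.
      + rewrite (is_derive_unique (fun x : R => Phi x) _ _ dt).
        replace (A + B * (cos (Phi t) * (cos (Phi t) * 1))) with (A + B * cos (Phi t) ^ 2)
          by ring.
        set (S := sqrt (A + B * cos (Phi t) ^ 2)) in *.
        pose proof (cos2_sin2 (Phi t)) as cs.
        set (C := cos (Phi t)) in *. set (N := sin (Phi t)) in *.
        set (r := sqrt 2) in *. set (b := sqrt B) in *.
        transitivity (- (b * k / r ^ 2) * C * (S ^ 2 - B * N ^ 2)); [field; lra|].
        rewrite es, e2. replace (N ^ 2) with (1 - C ^ 2) by lra.
        transitivity (b * k * C * m - b ^ 2 * b * k * C ^ 3); [|field; lra].
        rewrite eB. unfold A, B. field. }
  assert (hper : is_smallest_period y (2 * tau)).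
  { assert (ht : 0 < tau).
    { unfold tau; apply Rdiv_lt_0_compat; [apply half_turn_pos; lra|].
      now apply Rdiv_lt_0_compat. }
    split; [lra|split].
    - intros t. unfold y. f_equal. replace (t + 2 * tau) with (t + tau + tau) by ring.
      rewrite !per, !neg_cos. ring.
    - intros sigma hs hp.
      (* Time 0 is a maximum of [y], so a period must bring the angle back to a multiple of
         [2 PI]. *)
      assert (hc : cos (Phi sigma) = 1).
      { specialize (hp 0). unfold y in hp. rewrite Rplus_0_l, P0, cos_0 in hp.
        apply (Rmult_eq_reg_l (sqrt B / k)); [exact hp|].
        apply Rgt_not_eq. now apply Rdiv_lt_0_compat. }
      apply pos_cos_eq_1 in hc.
      + apply Rnot_lt_le; intros hl. apply inc in hl.
        replace (2 * tau) with (0 + tau + tau) in hl by ring.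
        rewrite !per, P0 in hl. lra.
      + rewrite <- P0. now apply inc. }
  assert (hS : 0 < A + k ^ 2 * u 0 ^ 2).
  { pose proof (pow2_ge_0 (k * u 0)). nra. }
  (* The cosine and sine are obtained by solving [y = u 0] and [dy = du 0] for the angle, with
     [A + k^2 u(0)^2] as the value of [A + B cos^2]. The energy relation is exactly what makes their
     squares add up to 1. *)
  destruct (exists_angle (k * u 0 / sqrt B)
              (- (du 0 * sqrt 2 / (sqrt B * sqrt (A + k ^ 2 * u 0 ^ 2))))) as [x [hx1 hx2]].
  { pose proof (sqrt_sq _ (Rlt_le _ _ hS)) as es. pose proof (sqrt_lt_R0 _ hS) as hs.
    set (S := sqrt (A + k ^ 2 * u 0 ^ 2)) in *.
    transitivity ((k ^ 2 * u 0 ^ 2 * S ^ 2 + du 0 ^ 2 * sqrt 2 ^ 2) / (sqrt B ^ 2 * S ^ 2)).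
    { field; lra. }
    rewrite es, eB, e2. unfold A, B in *.
    replace (du 0 ^ 2 * 2) with
      (D ^ 2 - m ^ 2 + 2 * k ^ 2 * m * u 0 ^ 2 - k ^ 4 * u 0 ^ 4) by lra.
    field; lra. }
  destruct (sur x) as [t1 ht1].
  apply (smallest_period_shift y u t1); [|exact hper].
  apply (duffing_unique (k ^ 2 * m) (k ^ 4) u du (fun t => y (t + t1)) (fun t => dy (t + t1)))
    with (t0 := 0); auto.
  - apply pow_lt; exact hk.
  - now apply duffing_shift.
  - unfold y. rewrite Rplus_0_l, ht1, hx1. field; lra.
  - unfold dy. rewrite Rplus_0_l, ht1, hx1, hx2.
    replace (A + B * (k * u 0 / sqrt B) ^ 2) with (A + k ^ 2 * u 0 ^ 2).
    + field. repeat split; try lra. apply Rgt_not_eq, sqrt_lt_R0, hS.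
    + rewrite <- eB at 1. field; lra.
Qed.

(** For negative energy the orbit cannot cross 0 and stays in the right-hand potential well. The
    explicit orbit depends on the angle only through [cos^2], so one half turn already closes it. *)
Lemma smallest_period_neg_right (k m D : R) (u du : R -> R)
  (hk : 0 < k) (hD : 0 < D < m)
  (hu : duffing (k ^ 2 * m) (k ^ 4) u du)
  (hE : 4 * (du 0 ^ 2 / 2 - k ^ 2 * m / 2 * u 0 ^ 2 + k ^ 4 / 4 * u 0 ^ 4) = D ^ 2 - m ^ 2)
  (h0 : 0 < u 0) :
  is_smallest_period u (sqrt 2 / k * half_turn (m - D) (2 * D)).
Proof.
  set (A := m - D). set (B := 2 * D).
  assert (hA : 0 < A) by (unfold A; lra). assert (hB : 0 < B) by (unfold B; lra).
  assert (h2 : 0 < sqrt 2) by (apply sqrt_lt_R0; lra).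
  assert (e2 : sqrt 2 ^ 2 = 2) by (apply sqrt_sq; lra).
  destruct (pendulum_flow A B (k / sqrt 2)) as [Phi [d [inc [sur [P0 per]]]]];
    [exact hA|lra|now apply Rdiv_lt_0_compat|].
  set (tau := half_turn A B / (k / sqrt 2)) in *.
  assert (etau : sqrt 2 / k * half_turn A B = tau) by (unfold tau; field; lra).
  rewrite etau.
  set (y := fun t => / k * sqrt (A + B * cos (Phi t) ^ 2)).
  set (dy := fun t => - (B / sqrt 2 * sin (Phi t) * cos (Phi t))).
  assert (hy : duffing (k ^ 2 * m) (k ^ 4) y dy).
  { split; intros t; pose proof (d t) as dt;
      pose proof (radicand_pos A B (Phi t) hA (Rlt_le _ _ hB)) as hr;
      pose proof (sqrt_lt_R0 _ hr) as hs;
      pose proof (sqrt_sq _ (Rlt_le _ _ hr)) as es.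
    - unfold y, dy. auto_derive.
      + repeat split; try (eexists; exact dt). simpl in hr; lra.
      + rewrite (is_derive_unique (fun x : R => Phi x) _ _ dt).
        replace (A + B * (cos (Phi t) * (cos (Phi t) * 1))) with (A + B * cos (Phi t) ^ 2)
          by ring.
        field; lra.
    - unfold y, dy. auto_derive; [repeat split; eexists; exact dt|].
      rewrite (is_derive_unique (fun x : R => Phi x) _ _ dt).
      set (S := sqrt (A + B * cos (Phi t) ^ 2)) in *.
      pose proof (cos2_sin2 (Phi t)) as cs.
      set (C := cos (Phi t)) in *. set (N := sin (Phi t)) in *.
      set (r := sqrt 2) in *.
      transitivity (- (B * k / r ^ 2) * S * (C ^ 2 - N ^ 2)); [field; lra|].
      transitivity (k * m * S - k * S * S ^ 2); [|field; lra].
      rewrite es, e2. replace (N ^ 2) with (1 - C ^ 2) by lra.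
      unfold A, B. field. }
  assert (hper : is_smallest_period y tau).
  { assert (ht : 0 < tau).
    { unfold tau; apply Rdiv_lt_0_compat; [apply half_turn_pos; lra|].
      now apply Rdiv_lt_0_compat. }
    split; [lra|split].
    - intros t. unfold y. rewrite per, neg_cos. do 2 f_equal. ring.
    - intros sigma hs hp.
      (* Equality with the maximum at time 0 forces [cos^2 = 1], so the angle has reached a multiple
         of [PI]. *)
      assert (hc : sin (Phi sigma) = 0).
      { specialize (hp 0). unfold y in hp. rewrite Rplus_0_l, P0, cos_0 in hp.
        apply Rmult_eq_reg_l in hp; [|apply Rgt_not_eq; now apply Rinv_0_lt_compat].
        apply sqrt_inj in hp;
          [|left; apply radicand_pos; lra|nra].
        pose proof (cos2_sin2 (Phi sigma)).
        apply Rsqr_0_uniq. unfold Rsqr. nra. }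
      apply pos_zero_sin in hc.
      + apply Rnot_lt_le; intros hl. apply inc in hl.
        replace tau with (0 + tau) in hl by ring.
        rewrite !per, P0 in hl. lra.
      + rewrite <- P0. now apply inc. }
  (* In the doubled angle the orbit reads [k^2 y^2 = m + D cos (2 Phi)] and
     [dy = - D / sqrt 2 * sin (2 Phi)]. So [x] is twice the required angle, and [t1] is the time at
     which [Phi] equals [x / 2]. *)
  destruct (exists_angle ((k ^ 2 * u 0 ^ 2 - m) / D) (- (sqrt 2 * du 0 / D)))
    as [x [hx1 hx2]].
  { transitivity ((k ^ 4 * u 0 ^ 4 - 2 * k ^ 2 * m * u 0 ^ 2 + m ^ 2
                   + sqrt 2 ^ 2 * du 0 ^ 2) / D ^ 2); [field; lra|].
    rewrite e2.
    replace (2 * du 0 ^ 2) with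
      (D ^ 2 - m ^ 2 + 2 * k ^ 2 * m * u 0 ^ 2 - k ^ 4 * u 0 ^ 4) by lra.
    field; lra. }
  destruct (sur (x / 2)) as [t1 ht1].
  replace x with (2 * (x / 2)) in hx1, hx2 by field.
  rewrite cos_2a_cos in hx1. rewrite sin_2a in hx2.
  apply (smallest_period_shift y u t1); [|exact hper].
  apply (duffing_unique (k ^ 2 * m) (k ^ 4) u du (fun t => y (t + t1)) (fun t => dy (t + t1)))
    with (t0 := 0); auto.
  - apply pow_lt; exact hk.
  - now apply duffing_shift.
  - unfold y. rewrite Rplus_0_l, ht1.
    replace (A + B * cos (x / 2) ^ 2) with ((k * u 0) ^ 2).
    + rewrite sqrt_pow2 by (left; now apply Rmult_lt_0_compat). field; lra.
    + transitivity (m + D * (2 * cos (x / 2) * cos (x / 2) - 1)).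
      * rewrite hx1. field; lra.
      * unfold A, B; ring.
  - unfold dy. rewrite Rplus_0_l, ht1.
    transitivity (- (D / sqrt 2 * (2 * sin (x / 2) * cos (x / 2)))).
    + rewrite hx2. field; lra.
    + unfold B. field; lra.
Qed.

(** The left well is the mirror image of the right one. The value [u 0 = 0] is impossible, since it
    would make the energy nonnegative. *)
Lemma smallest_period_neg (k m D : R) (u du : R -> R)
  (hk : 0 < k) (hD : 0 < D < m)
  (hu : duffing (k ^ 2 * m) (k ^ 4) u du)
  (hE : 4 * (du 0 ^ 2 / 2 - k ^ 2 * m / 2 * u 0 ^ 2 + k ^ 4 / 4 * u 0 ^ 4) = D ^ 2 - m ^ 2) :
  is_smallest_period u (sqrt 2 / k * half_turn (m - D) (2 * D)).
Proof.
  destruct (Rtotal_order 0 (u 0)) as [h|[h|h]].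
  - now apply smallest_period_neg_right with du.
  - exfalso. rewrite <- h in hE. nra.
  - apply (smallest_period_opp (fun t => - u t)); [intros; ring|].
    apply smallest_period_neg_right with (fun t => - du t); auto; [|nra|lra].
    now apply duffing_opp.
Qed.

(** * Bounds and monotonicity of the elliptic integral *)

(** For positive energy both [A = D - m] and [B = D + m] grow with [D], so a pointwise comparison of
    kernels suffices. *)
Lemma half_turn_decreasing (A1 A2 B1 B2 : R) (hA : 0 < A1 < A2) (hB : 0 <= B1 <= B2) :
  half_turn A2 B2 < half_turn A1 B1.
Proof.
  apply RInt_lt; [apply PI_RGT_0| | |].
  - intros; apply kernel_continuous; lra.
  - intros; apply kernel_continuous; lra.
  - intros x _. unfold kernel.
    pose proof (radicand_pos A1 B1 x) as h1.
    assert (h : A1 + B1 * cos x ^ 2 < A2 + B2 * cos x ^ 2).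
    { pose proof (pow2_ge_0 (cos x)). nra. }
    apply Rinv_lt_contravar.
    + apply Rmult_lt_0_compat; apply sqrt_lt_R0; lra.
    + apply sqrt_lt_1_alt; lra.
Qed.

Lemma half_turn_le (A B : R) (hA : 0 < A) (hB : 0 <= B) :
  half_turn A B <= PI / sqrt A.
Proof.
  pose proof PI_RGT_0.
  assert (e : RInt (fun _ => / sqrt A) 0 PI = PI / sqrt A).
  { rewrite RInt_const. unfold scal; simpl; unfold mult; simpl. unfold Rdiv; ring. }
  rewrite <- e. apply RInt_le; [lra| | |].
  - apply ex_RInt_cont; intros; now apply kernel_continuous.
  - apply ex_RInt_const.
  - intros x _. apply Rinv_le_contravar; [now apply sqrt_lt_R0|].
    apply sqrt_le_1_alt. pose proof (pow2_ge_0 (cos x)). nra.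
Qed.

Lemma half_turn_ge (A B : R) (hA : 0 < A) (hB : 0 <= B) :
  PI / sqrt (A + B) <= half_turn A B.
Proof.
  pose proof PI_RGT_0.
  assert (e : RInt (fun _ => / sqrt (A + B)) 0 PI = PI / sqrt (A + B)).
  { rewrite RInt_const. unfold scal; simpl; unfold mult; simpl. unfold Rdiv; ring. }
  rewrite <- e. apply RInt_le; [lra| | |].
  - apply ex_RInt_const.
  - apply ex_RInt_cont; intros; now apply kernel_continuous.
  - intros x _. apply Rinv_le_contravar; [apply sqrt_lt_R0, radicand_pos; lra|].
    apply sqrt_le_1_alt, radicand_le, hB.
Qed.

(* [cos x <= PI/2 - x] turns the integrand into that of a logarithm. *)
Lemma half_turn_ge_ln (A B : R) (hA : 0 < A) (hB : 0 < B) :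
  2 * (ln (sqrt A + sqrt B) - ln (sqrt A)) / sqrt B <= half_turn A B.
Proof.
  pose proof PI_RGT_0. pose proof PI2_1.
  assert (a0 := sqrt_lt_R0 _ hA). assert (b0 := sqrt_lt_R0 _ hB).
  set (a := sqrt A) in *. set (b := sqrt B) in *.
  rewrite half_turn_quarter by lra.
  set (F := fun x => - (ln (a + b * (PI / 2 - x)) / b)).
  assert (I : is_RInt (fun x => / (a + b * (PI / 2 - x))) 0 (PI / 2) (F (PI / 2) - F 0)).
  { apply (is_RInt_derive F);
      rewrite Rmin_left, Rmax_right by lra; intros x hx;
      assert (0 < a + b * (PI / 2 - x)) by
        (apply Rplus_lt_le_0_compat; [|apply Rmult_le_pos]; lra).
    - unfold F; auto_derive; [lra|field; lra].
    - apply (ex_derive_continuous (fun x => / (a + b * (PI / 2 - x)))).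
      auto_derive; lra. }
  apply Rle_trans with (2 * (F (PI / 2) - F 0)).
  - unfold F. replace (PI / 2 - PI / 2) with 0 by ring.
    rewrite Rmult_0_r, Rplus_0_r, Rminus_0_r.
    (* This uses [1 < PI / 2]. *)
    assert (ln (a + b) <= ln (a + b * (PI / 2))) by (apply ln_le; nra).
    apply (Rmult_le_reg_r b); [exact b0|].
    field_simplify; lra.
  - apply Rmult_le_compat_l; [lra|].
    rewrite <- (is_RInt_unique _ _ _ _ I).
    apply RInt_le; [lra|eexists; exact I| |].
    + apply ex_RInt_cont; intros; apply kernel_continuous; lra.
    + intros x hx.
      assert (hr : 0 < A + B * cos x ^ 2) by (apply radicand_pos; lra).
      apply Rinv_le_contravar; [now apply sqrt_lt_R0|].
      assert (0 <= cos x) by (apply cos_ge_0; lra).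
      assert (cos x <= PI / 2 - x) by
        (rewrite <- sin_shift; left; apply sin_lt_x; lra).
      assert (0 <= b * cos x <= b * (PI / 2 - x)) by
        (split; [apply Rmult_le_pos|apply Rmult_le_compat_l]; lra).
      assert (ea : a ^ 2 = A) by (apply sqrt_sq; lra).
      assert (eb : b ^ 2 = B) by (apply sqrt_sq; lra).
      (* For nonnegative terms a sum of squares is at most the square of the sum, so [a^2 + (b cos
         x)^2 <= (a + b (PI / 2 - x))^2]. *)
      rewrite <- (sqrt_pow2 (a + b * (PI / 2 - x))) by lra.
      apply sqrt_le_1_alt. rewrite <- ea, <- eb. nra.
Qed.

(** With [A = m - D] and [B = 2D], raising [D] lowers the kernel on [(0, PI / 4)] and raises it on
    [(PI / 4, PI / 2)]. Only the folded sum can be compared pointwise. *)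
Lemma half_turn_fold (A B : R) (hA : 0 < A) (hB : 0 <= B) :
  half_turn A B =
  2 * RInt (fun x => kernel A B x + kernel A B (PI / 2 - x)) 0 (PI / 4).
Proof.
  pose proof (kernel_continuous A B hA hB) as kc.
  rewrite half_turn_quarter by assumption. f_equal.
  rewrite (RInt_Chasles_cont _ kc 0 (PI / 4)).
  pose proof (RInt_reflect _ kc (PI / 2) 0 (PI / 4)) as H.
  replace (PI / 2 - PI / 4) with (PI / 4) in H by field.
  rewrite Rminus_0_r in H. rewrite <- H. symmetry.
  apply (RInt_plus (kernel A B)); apply ex_RInt_cont; intros x; [apply kc|].
  apply (continuous_comp (fun y => PI / 2 - y)); [|apply kc].
  apply (ex_derive_continuous (fun y => PI / 2 - y)); auto_derive; trivial.
Qed.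

(** The square of the sum at [c] is [2m / (m^2 - c^2) + 2 / sqrt (m^2 - c^2)], where both terms
    visibly increase with [c]. *)
Lemma inv_sqrt_symmetric_lt (m a b : R) (ha : 0 <= a < b) (hb : b < m) :
  / sqrt (m + a) + / sqrt (m - a) < / sqrt (m + b) + / sqrt (m - b).
Proof.
  assert (sq : forall c, 0 <= c < m ->
     0 < / sqrt (m + c) + / sqrt (m - c) /\
     (/ sqrt (m + c) + / sqrt (m - c)) ^ 2 = 2 * m / (m ^ 2 - c ^ 2) + 2 * / sqrt (m ^ 2 - c ^ 2)).
  { intros c hc.
    assert (h1 : 0 < m + c) by lra. assert (h2 : 0 < m - c) by lra.
    assert (s1 := sqrt_lt_R0 _ h1). assert (s2 := sqrt_lt_R0 _ h2).
    assert (e1 := sqrt_sq _ (Rlt_le _ _ h1)). assert (e2 := sqrt_sq _ (Rlt_le _ _ h2)).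
    split; [apply Rplus_lt_0_compat; now apply Rinv_0_lt_compat|].
    replace (m ^ 2 - c ^ 2) with ((m + c) * (m - c)) by ring.
    rewrite sqrt_mult by lra.
    set (p := sqrt (m + c)) in *. set (q := sqrt (m - c)) in *.
    transitivity ((p ^ 2 + q ^ 2) / (p ^ 2 * q ^ 2) + 2 * / (p * q)); [field; lra|].
    rewrite e1, e2. f_equal. f_equal. ring. }
  destruct (sq a) as [p1 q1]; [lra|]. destruct (sq b) as [p2 q2]; [lra|].
  apply Rnot_le_lt; intros hle.
  assert (h : (/ sqrt (m + b) + / sqrt (m - b)) ^ 2 <= (/ sqrt (m + a) + / sqrt (m - a)) ^ 2)
    by (apply pow_incr; lra).
  rewrite q1, q2 in h.
  assert (l1 : 0 < m ^ 2 - b ^ 2) by nra. assert (l2 : m ^ 2 - b ^ 2 < m ^ 2 - a ^ 2) by nra.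
  assert (2 * m / (m ^ 2 - a ^ 2) < 2 * m / (m ^ 2 - b ^ 2)).
  { apply Rmult_lt_compat_l; [lra|]. apply Rinv_lt_contravar; [nra|lra]. }
  assert (/ sqrt (m ^ 2 - a ^ 2) < / sqrt (m ^ 2 - b ^ 2)).
  { apply Rinv_lt_contravar.
    - apply Rmult_lt_0_compat; apply sqrt_lt_R0; lra.
    - apply sqrt_lt_1_alt; lra. }
  lra.
Qed.

Lemma half_turn_spread (m D1 D2 : R) (hD : 0 < D1 < D2) (hm : D2 < m) :
  half_turn (m - D1) (2 * D1) < half_turn (m - D2) (2 * D2).
Proof.
  rewrite !half_turn_fold by lra.
  apply Rmult_lt_compat_l; [lra|]. pose proof PI_RGT_0.
  assert (cont : forall D x, 0 < D < m ->
    continuous (fun x => kernel (m - D) (2 * D) x + kernel (m - D) (2 * D) (PI / 2 - x)) x).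
  { intros D x h.
    apply (continuous_plus (kernel (m - D) (2 * D))).
    - apply kernel_continuous; lra.
    - apply (continuous_comp (fun y => PI / 2 - y)); [|apply kernel_continuous; lra].
      apply (ex_derive_continuous (fun y => PI / 2 - y)); auto_derive; trivial. }
  apply RInt_lt; [lra| | |].
  - intros; apply cont; lra.
  - intros; apply cont; lra.
  - intros x hx.
    assert (e : forall D, kernel (m - D) (2 * D) x + kernel (m - D) (2 * D) (PI / 2 - x)
                   = / sqrt (m + D * cos (2 * x)) + / sqrt (m - D * cos (2 * x))).
    { intros D. unfold kernel. rewrite cos_shift.
      replace (m - D + 2 * D * cos x ^ 2) with (m + D * cos (2 * x))
        by (rewrite cos_2a_cos; ring).
      replace (m - D + 2 * D * sin x ^ 2) with (m - D * cos (2 * x))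
        by (rewrite cos_2a_sin; ring).
      reflexivity. }
    rewrite !e.
    (* Folding at [PI / 4] makes [cos (2 x)] positive, so the spread [D cos (2 x)] increases
       strictly with [D]. *)
    assert (0 < cos (2 * x)) by (apply cos_gt_0; lra).
    pose proof (COS_bound (2 * x)).
    apply inv_sqrt_symmetric_lt; nra.
Qed.

(** * Legendre forms as improper integrals *)

(** Fundamental theorem for improper integrals. The antiderivative [K] is required only between
    endpoints near the limits, which allows integrands singular at the ends; general filters cover
    both ordinary and singular endpoints. *)
Lemma is_RInt_gen_antiderivative {Fa Fb : (R -> Prop) -> Prop}
  {FFa : Filter Fa} {FFb : Filter Fb} (f K : R -> R) (la lb : R)
  (hK : filter_prod Fa Fb (fun ab => forall x, Rmin (fst ab) (snd ab) <= x <= Rmax (fst ab) (snd ab) ->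
                          is_derive K x (f x) /\ continuous f x))
  (ha : filterlim K Fa (locally la)) (hb : filterlim K Fb (locally lb)) :
  is_RInt_gen f Fa Fb (lb - la).
Proof.
  intros P hP.
  assert (lim : filterlim (fun ab : R * R => K (snd ab) - K (fst ab)) (filter_prod Fa Fb)
                  (locally (lb - la))).
  { apply (filterlim_comp_2 (G := locally lb) (H := locally (- la))
      (fun ab : R * R => K (snd ab)) (fun ab => - K (fst ab)) Rplus).
    - apply (filterlim_comp _ _ _ (fun ab : R * R => snd ab) K _ Fb);
        [apply filterlim_snd|exact hb].
    - apply (filterlim_comp _ _ _ (fun ab : R * R => K (fst ab)) Ropp _ (locally la)).
      + apply (filterlim_comp _ _ _ (fun ab : R * R => fst ab) K _ Fa);
          [apply filterlim_fst|exact ha].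
      + apply (filterlim_opp (V := R_NormedModule) la).
    - apply (filterlim_plus (V := R_NormedModule) lb (- la)). }
  assert (hl := lim P hP). unfold filtermap in hl.
  unfold filtermapi.
  generalize (filter_and _ _ hK hl). apply filter_imp.
  intros [a b] [h1 h2]. exists (K b - K a); split; [|exact h2].
  apply (is_RInt_derive K); intros x hx; now apply (h1 x).
Qed.

Lemma filterlim_at_left {T : Type} {F : (T -> Prop) -> Prop} {FF : Filter F}
  (f : T -> R) (y : R) (h1 : filterlim f F (locally y)) (h2 : F (fun x => f x < y)) :
  filterlim f F (at_left y).
Proof.
  intros P hP. assert (h := h1 _ hP). unfold filtermap in h.
  unfold filtermap, at_left, at_right, within.
  generalize (filter_and _ _ h2 h). apply filter_imp.
  intros x [a b]; auto.
Qed.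

Lemma filterlim_at_right {T : Type} {F : (T -> Prop) -> Prop} {FF : Filter F}
  (f : T -> R) (y : R) (h1 : filterlim f F (locally y)) (h2 : F (fun x => y < f x)) :
  filterlim f F (at_right y).
Proof.
  intros P hP. assert (h := h1 _ hP). unfold filtermap in h.
  unfold filtermap, at_left, at_right, within.
  generalize (filter_and _ _ h2 h). apply filter_imp.
  intros x [a b]; auto.
Qed.

Lemma at_left_between (a b : R) (hab : a < b) : at_left b (fun x => a < x < b).
Proof.
  assert (h : 0 < b - a) by lra.
  exists (mkposreal _ h); simpl; intros x hx hlt.
  apply Rabs_lt_between in hx. unfold minus, plus, opp in hx; simpl in hx. lra.
Qed.

Lemma at_right_between (a b : R) (hab : a < b) : at_right a (fun x => a < x < b).
Proof.
  assert (h : 0 < b - a) by lra.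
  exists (mkposreal _ h); simpl; intros x hx hlt.
  apply Rabs_lt_between in hx. unfold minus, plus, opp in hx; simpl in hx. lra.
Qed.

(** [acos] is not differentiable at 1, so the limit comes from the monotonicity of [cos] on
    [[0, PI]]; the minimum with [PI] keeps the comparison angle in that interval. *)
Lemma filterlim_acos_1 : filterlim acos (at_left 1) (locally 0).
Proof.
  apply filterlim_locally; intros eps.
  pose proof PI_RGT_0. pose proof (cond_pos eps).
  set (e := Rmin eps PI).
  assert (he : 0 < e <= PI) by (split; [apply Rmin_pos; lra|apply Rmin_r]).
  assert (hc : cos e < 1) by (rewrite <- cos_0; apply cos_decreasing_1; lra).
  pose proof (COS_bound e).
  generalize (at_left_between _ _ hc). apply filter_imp. intros x hx.
  assert (acos x < e).
  { pose proof (acos_bound x). apply cos_decreasing_0; try lra.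
    rewrite cos_acos; lra. }
  pose proof (acos_bound x). pose proof (Rmin_l eps PI). fold e in H4.
  apply Rabs_lt_between. unfold minus, plus, opp; simpl. lra.
Qed.

Lemma filterlim_acos_m1 : filterlim acos (at_right (-1)) (locally PI).
Proof.
  apply filterlim_locally; intros eps.
  pose proof PI_RGT_0. pose proof (cond_pos eps).
  set (e := Rmin eps PI).
  assert (he : 0 < e <= PI) by (split; [apply Rmin_pos; lra|apply Rmin_r]).
  assert (hc : -1 < cos (PI - e)) by (rewrite <- cos_PI; apply cos_decreasing_1; lra).
  pose proof (COS_bound (PI - e)).
  generalize (at_right_between _ _ hc). apply filter_imp. intros x hx.
  assert (PI - e < acos x).
  { pose proof (acos_bound x). apply cos_decreasing_0; try lra.
    rewrite cos_acos; lra. }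
  pose proof (acos_bound x). pose proof (Rmin_l eps PI). fold e in H4.
  apply Rabs_lt_between. unfold minus, plus, opp; simpl. lra.
Qed.

Lemma is_derive_acos (x : R) (hx : -1 < x < 1) :
  is_derive acos x (- / sqrt (1 - x ^ 2)).
Proof.
  apply is_derive_Reals.
  replace (- / sqrt (1 - x ^ 2)) with (derive_pt acos x (derivable_pt_acos x hx)).
  - apply (proj2_sig (derivable_pt_acos x hx)).
  - rewrite derive_pt_acos, Rsqr_pow2. unfold Rdiv; ring.
Qed.

(** The substitution [x = cos phi] appears as the antiderivative [- k G (acos x)]. Since
    [acos 0 = PI / 2], it yields a quarter turn. *)
Lemma is_RInt_gen_legendre_pos (k A B : R) (hk : 0 < k) (hA : 0 < A) (hB : 0 <= B) :
  is_RInt_gen (fun x => 1 / sqrt ((A / k ^ 2 + B / k ^ 2 * x ^ 2) * (1 - x ^ 2)))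
    (at_point 0) (at_left 1) (k * half_turn A B / 2).
Proof.
  pose proof (kernel_continuous A B hA hB) as kc.
  set (G := fun x => RInt (kernel A B) 0 x).
  assert (dG : forall x, is_derive G x (kernel A B x))
    by (intros; apply (is_derive_RInt_cont _ kc)).
  assert (G0 : G 0 = 0) by apply (RInt_point (V := R_CompleteNormedModule)).
  replace (k * half_turn A B / 2) with (0 - (- k * G (acos 0))).
  2:{ rewrite half_turn_quarter by assumption. rewrite acos_0. unfold G. field. }
  apply is_RInt_gen_antiderivative with (K := fun x => - k * G (acos x)).
  - exists (fun x => x = 0) (fun x => 0 < x < 1); [reflexivity|apply at_left_between; lra|].
    intros a b -> hb x; cbn [fst snd]. rewrite Rmin_left, Rmax_right by lra. intros hx.
    assert (h1 : 0 < 1 - x ^ 2) by nra.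
    assert (h2 : 0 < A + B * x ^ 2) by nra.
    assert (hk2 : 0 < k ^ 2) by (apply pow_lt; exact hk).
    assert (e : A / k ^ 2 + B / k ^ 2 * x ^ 2 = (A + B * x ^ 2) / k ^ 2) by (field; lra).
    assert (h3 : 0 < A / k ^ 2 + B / k ^ 2 * x ^ 2)
      by (rewrite e; now apply Rdiv_lt_0_compat).
    split.
    + replace (1 / sqrt ((A / k ^ 2 + B / k ^ 2 * x ^ 2) * (1 - x ^ 2))) with
        (- k * (- / sqrt (1 - x ^ 2) * kernel A B (acos x))).
      * apply (is_derive_scal (fun x => G (acos x))).
        apply (is_derive_comp G acos); [apply dG|apply is_derive_acos; lra].
      * unfold kernel. rewrite cos_acos by lra.
        rewrite e. unfold Rdiv. rewrite sqrt_mult by (try apply Rmult_le_pos; try lra;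
          left; now apply Rinv_0_lt_compat).
        rewrite sqrt_mult by (try lra; left; now apply Rinv_0_lt_compat).
        rewrite sqrt_inv, sqrt_pow2 by lra.
        apply sqrt_lt_R0 in h1, h2. field; lra.
    + apply (ex_derive_continuous
               (fun x => 1 / sqrt ((A / k ^ 2 + B / k ^ 2 * x ^ 2) * (1 - x ^ 2)))).
      assert (h4 : 0 < (A / k ^ 2 + B / k ^ 2 * x ^ 2) * (1 - x ^ 2))
        by now apply Rmult_lt_0_compat.
      pose proof (sqrt_lt_R0 _ h4).
      auto_derive. unfold Rminus in *. simpl in *. repeat split; lra.
  - intros P hP. apply (locally_singleton _ _ hP).
  - replace 0 with (- k * G 0) at 1 by (rewrite G0; ring).
    apply (filterlim_comp _ _ _ acos (fun x => - k * G x) _ (locally 0)); [apply filterlim_acos_1|].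
    apply (ex_derive_continuous (fun x => - k * G x)).
    eexists. apply (is_derive_scal G), dG.
Qed.

(** The substitution [x^2 = (A + B cos^2 phi) / (A + B)] is written through the doubled angle. Then
    [cos (2 phi)] is the polynomial [u x], which carries [[d, 1]] onto [[-1, 1]], and the
    antiderivative is [- s G (acos (u x) / 2)]. *)
Lemma is_RInt_gen_legendre_neg (A B d : R) (hA : 0 < A) (hB : 0 < B) (hd : 0 < d < 1)
  (e : d ^ 2 = A / (A + B)) :
  is_RInt_gen (fun x => 1 / sqrt ((1 - x ^ 2) * (x ^ 2 - d ^ 2)))
    (at_right d) (at_left 1) (sqrt (A + B) * half_turn A B / 2).
Proof.
  assert (hB' : 0 <= B) by lra.
  pose proof (kernel_continuous A B hA hB') as kc.
  set (G := fun x => RInt (kernel A B) 0 x).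
  assert (dG : forall x, is_derive G x (kernel A B x))
    by (intros; apply (is_derive_RInt_cont _ kc)).
  assert (G0 : G 0 = 0) by apply (RInt_point (V := R_CompleteNormedModule)).
  assert (hs : 0 < sqrt (A + B)) by (apply sqrt_lt_R0; lra).
  set (s := sqrt (A + B)) in *.
  set (u := fun x => 2 * (A + B) / B * (x ^ 2 - d ^ 2) - 1).
  assert (hq : 0 < 2 * (A + B) / B) by (apply Rdiv_lt_0_compat; lra).
  assert (ud : u d = -1) by (unfold u; ring).
  assert (u1 : u 1 = 1) by (unfold u; rewrite e; field; lra).
  assert (um : forall x, 1 - u x = 2 * (A + B) / B * (1 - x ^ 2)).
  { intros x; unfold u; rewrite e; field; lra. }
  assert (ub : forall x, d < x < 1 -> -1 < u x < 1).
  { intros x hx; split.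
    - unfold u. assert (0 < x ^ 2 - d ^ 2) by nra. nra.
    - assert (0 < 1 - u x); [|lra]. rewrite um. apply Rmult_lt_0_compat; nra. }
  assert (du : forall x, is_derive u x (2 * (A + B) / B * (2 * x))).
  { intros x; unfold u; auto_derive; trivial; field; lra. }
  assert (cu : forall x, filterlim u (locally x) (locally (u x))).
  { intros x; apply (ex_derive_continuous u); eexists; apply du. }
  set (K := fun y => - s * G (y / 2)).
  assert (dK : forall y, is_derive K y (- s * (/ 2 * kernel A B (y / 2)))).
  { intros y. apply (is_derive_scal (fun y => G (y / 2))).
    apply (is_derive_comp G (fun y => y / 2)); [apply dG|].
    auto_derive; trivial; lra. }
  assert (cK : forall y, filterlim K (locally y) (locally (K y))).
  { intros y; apply (ex_derive_continuous K); eexists; apply dK. }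
  replace (s * half_turn A B / 2) with (K 0 - K PI).
  2:{ rewrite half_turn_quarter by assumption.
      unfold K. replace (0 / 2) with 0 by field. rewrite G0. unfold G. field. }
  apply is_RInt_gen_antiderivative with (K := fun x => K (acos (u x))).
  - exists (fun x => d < x < 1) (fun x => d < x < 1);
      [apply at_right_between; lra|apply at_left_between; lra|].
    intros a b ha hb x hx; simpl in hx.
    assert (hx' : d < x < 1).
    { revert hx; unfold Rmin, Rmax; destruct (Rle_dec a b); lra. }
    assert (h1 : 0 < 1 - x ^ 2) by nra.
    assert (h2 : 0 < x ^ 2 - d ^ 2) by nra.
    assert (h4 : 0 < (1 - x ^ 2) * (x ^ 2 - d ^ 2)) by now apply Rmult_lt_0_compat.
    pose proof (sqrt_lt_R0 _ h4) as h5.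
    split.
    + replace (1 / sqrt ((1 - x ^ 2) * (x ^ 2 - d ^ 2))) with
        ((2 * (A + B) / B * (2 * x)) * - / sqrt (1 - u x ^ 2)
          * (- s * (/ 2 * kernel A B (acos (u x) / 2)))).
      * apply (is_derive_comp K (fun x => acos (u x))); [apply dK|].
        apply (is_derive_comp acos u); [apply is_derive_acos, ub, hx'|apply du].
      * assert (ek : kernel A B (acos (u x) / 2) = / (s * x)).
        { unfold kernel. f_equal.
          replace (A + B * cos (acos (u x) / 2) ^ 2) with ((A + B) * x ^ 2).
          - rewrite sqrt_mult, sqrt_pow2 by (try apply pow2_ge_0; lra). reflexivity.
          - assert (ec : u x = 2 * cos (acos (u x) / 2) ^ 2 - 1).
            { rewrite <- (cos_acos (u x)) at 1 by (specialize (ub x hx'); lra).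
              replace (acos (u x)) with (2 * (acos (u x) / 2)) at 1 by field.
              rewrite cos_2a_cos; ring. }
            replace (cos (acos (u x) / 2) ^ 2) with ((u x + 1) / 2) by lra.
            unfold u. rewrite e. field; lra. }
        (* The factors [1 - u] and [1 + u] are [2 (A + B) / B] times [1 - x^2] and [x^2 - d^2]
           respectively. *)
        assert (es : sqrt (1 - u x ^ 2) = 2 * (A + B) / B * sqrt ((1 - x ^ 2) * (x ^ 2 - d ^ 2))).
        { rewrite <- (sqrt_pow2 (2 * (A + B) / B)) at 1 by lra.
          rewrite <- sqrt_mult by (try apply pow2_ge_0; lra). f_equal.
          transitivity ((1 - u x) * (1 + u x)); [ring|].
          rewrite um. unfold u; ring. }
        rewrite ek, es. field. repeat split; lra.
    + apply (ex_derive_continuous (fun x => 1 / sqrt ((1 - x ^ 2) * (x ^ 2 - d ^ 2)))).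
      auto_derive. unfold Rminus in *. simpl in *. repeat split; lra.
  - apply (filterlim_comp _ _ _ u (fun y => K (acos y)) _ (at_right (-1))).
    + apply filterlim_at_right.
      * rewrite <- ud. apply (filterlim_filter_le_1 (F := locally d)); [|apply cu].
        apply filter_le_within.
      * generalize (at_right_between d 1 (proj2 hd)); apply filter_imp.
        intros x hx; apply ub in hx; lra.
    + apply (filterlim_comp _ _ _ acos K _ (locally PI)); [apply filterlim_acos_m1|apply cK].
  - apply (filterlim_comp _ _ _ u (fun y => K (acos y)) _ (at_left 1)).
    + apply filterlim_at_left.
      * rewrite <- u1 at 2. apply (filterlim_filter_le_1 (F := locally 1)); [|apply cu].
        apply filter_le_within.
      * generalize (at_left_between d 1 (proj2 hd)); apply filter_imp.
        intros x hx; apply ub in hx; lra.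
    + apply (filterlim_comp _ _ _ acos K _ (locally 0)); [apply filterlim_acos_1|apply cK].
Qed.

(** * The period as a function of the energy *)

(** Here [m] is [P - k^2]. At [E = 0] the second branch returns a value without dynamical meaning;
    the limit there is over punctured neighbourhoods. *)
Definition period (k m E : R) : R :=
  let D := sqrt (m ^ 2 + 4 * E) in
  if Rlt_dec E 0 then sqrt 2 / k * half_turn (m - D) (2 * D)
  else 2 * (sqrt 2 / k * half_turn (D - m) (D + m)).

Lemma period_neg (k m E : R) (hE : E < 0) :
  period k m E =
  sqrt 2 / k * half_turn (m - sqrt (m ^ 2 + 4 * E)) (2 * sqrt (m ^ 2 + 4 * E)).
Proof. unfold period; destruct Rlt_dec; [reflexivity|lra]. Qed.

Lemma period_pos (k m E : R) (hE : 0 < E) :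
  period k m E =
  2 * (sqrt 2 / k * half_turn (sqrt (m ^ 2 + 4 * E) - m) (sqrt (m ^ 2 + 4 * E) + m)).
Proof. unfold period; destruct Rlt_dec; [lra|reflexivity]. Qed.

Lemma sqrt_disc_neg (m E : R) (hm : 0 < m) (hE : - (m ^ 2 / 4) < E < 0) :
  0 < sqrt (m ^ 2 + 4 * E) < m.
Proof.
  split; [apply sqrt_lt_R0; lra|].
  rewrite <- (sqrt_pow2 m) at 2 by lra. apply sqrt_lt_1_alt; lra.
Qed.

Lemma sqrt_disc_pos (m E : R) (hm : 0 < m) (hE : 0 < E) :
  m < sqrt (m ^ 2 + 4 * E).
Proof.
  rewrite <- (sqrt_pow2 m) at 1 by lra. apply sqrt_lt_1_alt.
  pose proof (pow2_ge_0 m); lra.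
Qed.

Lemma sqrt_disc_lt (m E1 E2 : R) (h1 : - (m ^ 2 / 4) < E1) (h : E1 < E2) :
  sqrt (m ^ 2 + 4 * E1) < sqrt (m ^ 2 + 4 * E2).
Proof. apply sqrt_lt_1_alt; lra. Qed.

Lemma sqrt_disc_continuous (m E : R) :
  filterlim (fun e => sqrt (m ^ 2 + 4 * e)) (locally E) (locally (sqrt (m ^ 2 + 4 * E))).
Proof.
  apply (continuous_comp (fun e => m ^ 2 + 4 * e) sqrt); [|apply continuous_sqrt].
  apply (ex_derive_continuous (fun e => m ^ 2 + 4 * e)); auto_derive; trivial.
Qed.

Lemma period_smallest (k m E : R) (u du : R -> R) (hk : 0 < k) (hm : 0 < m)
  (hu : duffing (k ^ 2 * m) (k ^ 4) u du)
  (e : du 0 ^ 2 / 2 - k ^ 2 * m / 2 * u 0 ^ 2 + k ^ 4 / 4 * u 0 ^ 4 = E)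
  (hE : - (m ^ 2 / 4) < E < 0 \/ 0 < E) :
  is_smallest_period u (period k m E).
Proof.
  assert (hD : 4 * E = sqrt (m ^ 2 + 4 * E) ^ 2 - m ^ 2).
  { rewrite sqrt_sq; [ring|]. pose proof (pow2_ge_0 m). lra. }
  destruct hE as [hE|hE].
  - rewrite period_neg by lra.
    apply smallest_period_neg with du; auto; [now apply sqrt_disc_neg|].
    now rewrite e.
  - rewrite period_pos by lra.
    apply smallest_period_pos with du; auto; [now apply sqrt_disc_pos|].
    now rewrite e.
Qed.

Lemma period_increasing (k m E1 E2 : R) (hk : 0 < k) (hm : 0 < m)
  (h1 : - (m ^ 2 / 4) < E1) (h : E1 < E2) (h2 : E2 < 0) :
  period k m E1 < period k m E2.
Proof.
  rewrite !period_neg by lra.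
  apply Rmult_lt_compat_l; [apply Rdiv_lt_0_compat; [apply sqrt_lt_R0|]; lra|].
  pose proof (sqrt_disc_lt m E1 E2 h1 h).
  pose proof (sqrt_disc_neg m E1 hm). pose proof (sqrt_disc_neg m E2 hm).
  apply half_turn_spread; lra.
Qed.

Lemma period_decreasing (k m E1 E2 : R) (hk : 0 < k) (hm : 0 < m)
  (h1 : 0 < E1) (h : E1 < E2) :
  period k m E2 < period k m E1.
Proof.
  rewrite !period_pos by lra.
  apply Rmult_lt_compat_l; [lra|].
  apply Rmult_lt_compat_l; [apply Rdiv_lt_0_compat; [apply sqrt_lt_R0|]; lra|].
  pose proof (pow2_ge_0 m).
  assert (h3 : sqrt (m ^ 2 + 4 * E1) < sqrt (m ^ 2 + 4 * E2)) by (apply sqrt_disc_lt; lra).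
  pose proof (sqrt_disc_pos m E1 hm h1).
  apply half_turn_decreasing; lra.
Qed.

(** * Limits of the period function *)

(** As [D] tends to 0 the half turn is squeezed between [PI / sqrt (m + D)] and [PI / sqrt (m - D)].
    The parameter [s], taken as 1 and -1, treats both bounds at once. *)
Lemma period_limit_bottom (k m : R) (hk : 0 < k) (hm : 0 < m) :
  filterlim (period k m) (at_right (- (m ^ 2 / 4)))
    (locally (PI * sqrt 2 / (k * sqrt m))).
Proof.
  assert (hs : 0 < sqrt m) by now apply sqrt_lt_R0.
  assert (hc : 0 < sqrt 2 / k) by (apply Rdiv_lt_0_compat; [apply sqrt_lt_R0|]; lra).
  assert (lim : forall s, filterlim
     (fun E => sqrt 2 / k * (PI / sqrt (m + s * sqrt (m ^ 2 + 4 * E))))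
     (at_right (- (m ^ 2 / 4))) (locally (PI * sqrt 2 / (k * sqrt m)))).
  { intros s.
    apply (filterlim_comp _ _ _ (fun E => sqrt (m ^ 2 + 4 * E))
             (fun d => sqrt 2 / k * (PI / sqrt (m + s * d))) _ (locally 0)).
    - replace 0 with (sqrt (m ^ 2 + 4 * - (m ^ 2 / 4)))
        by (rewrite <- sqrt_0; f_equal; field).
      apply (filterlim_filter_le_1 (F := locally (- (m ^ 2 / 4))));
        [apply filter_le_within|apply sqrt_disc_continuous].
    - replace (PI * sqrt 2 / (k * sqrt m)) with (sqrt 2 / k * (PI / sqrt (m + s * 0))).
      + apply (ex_derive_continuous (fun d => sqrt 2 / k * (PI / sqrt (m + s * d)))).
        auto_derive. rewrite Rmult_0_r, Rplus_0_r. repeat split; lra.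
      + rewrite Rmult_0_r, Rplus_0_r. field; lra. }
  apply (filterlim_le_le
           (fun E => sqrt 2 / k * (PI / sqrt (m + 1 * sqrt (m ^ 2 + 4 * E)))) _
           (fun E => sqrt 2 / k * (PI / sqrt (m + -1 * sqrt (m ^ 2 + 4 * E))))
           (PI * sqrt 2 / (k * sqrt m))); [|apply lim|apply lim].
  assert (h0 : - (m ^ 2 / 4) < 0) by nra.
  generalize (at_right_between _ _ h0). apply filter_imp. intros E hE.
  pose proof (sqrt_disc_neg m E hm hE).
  rewrite period_neg by lra.
  set (D := sqrt (m ^ 2 + 4 * E)) in *.
  replace (m + 1 * D) with (m - D + 2 * D) by ring.
  replace (m + -1 * D) with (m - D) by ring.
  split; (apply Rmult_le_compat_l; [lra|]).
  - apply half_turn_ge; lra.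
  - apply half_turn_le; lra.
Qed.

Lemma period_limit_top (k m : R) (hk : 0 < k) (hm : 0 < m) :
  is_lim (period k m) p_infty 0.
Proof.
  apply is_lim_spec; intros eps.
  assert (h2 : 0 < sqrt 2) by (apply sqrt_lt_R0; lra).
  pose proof PI_RGT_0 as hpi. pose proof (cond_pos eps) as he.
  set (Q := 2 * (sqrt 2 / k) * PI / eps).
  assert (hc : 0 < 2 * (sqrt 2 / k)) by
    (apply Rmult_lt_0_compat; [lra|now apply Rdiv_lt_0_compat]).
  assert (hQ : 0 < Q) by
    (apply Rdiv_lt_0_compat; [apply Rmult_lt_0_compat|]; lra).
  (* Beyond this energy [D > m + Q^2], hence [sqrt (D - m) > Q]; and [Q] is the value at which the
     upper bound on the period equals [eps]. *)
  exists ((m + Q ^ 2) ^ 2); intros E hE.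
  pose proof (pow2_ge_0 (m + Q ^ 2)). pose proof (pow2_ge_0 m).
  assert (hE0 : 0 < E) by lra.
  rewrite period_pos by exact hE0.
  pose proof (sqrt_disc_pos m E hm hE0) as hD.
  assert (hD2 : m + Q ^ 2 < sqrt (m ^ 2 + 4 * E)).
  { pose proof (pow2_ge_0 Q).
    rewrite <- (sqrt_pow2 (m + Q ^ 2)) by lra. apply sqrt_lt_1_alt; lra. }
  set (D := sqrt (m ^ 2 + 4 * E)) in *.
  assert (hA : 0 < D - m) by lra. assert (hB : 0 <= D + m) by lra.
  pose proof (half_turn_pos _ _ hA hB). pose proof (half_turn_le _ _ hA hB) as hle.
  rewrite Rminus_0_r, <- Rmult_assoc, Rabs_right
    by (left; now apply Rmult_lt_0_compat).
  apply Rle_lt_trans with (2 * (sqrt 2 / k) * (PI / sqrt (D - m))).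
  { apply Rmult_le_compat_l; lra. }
  assert (hq : Q < sqrt (D - m)).
  { rewrite <- (sqrt_pow2 Q) by lra. apply sqrt_lt_1_alt; split; [apply pow2_ge_0|lra]. }
  apply (Rmult_lt_reg_r (sqrt (D - m))); [lra|].
  apply Rle_lt_trans with (eps * Q).
  - right. unfold Q. field. repeat split; lra.
  - now apply Rmult_lt_compat_l.
Qed.

(** The range of [B] accommodates both [2D] and [D + m] once [D] is within [m / 2] of [m]. What
    remains is a logarithm diverging as [A] tends to 0. *)
Lemma half_turn_ge_ln_bounded (A B m : R) (hA : 0 < A < m) (hB : m <= B <= 3 * m) :
  2 / sqrt (3 * m) * (ln (sqrt m) - ln (sqrt A)) <= half_turn A B.
Proof.
  assert (a0 : 0 < sqrt A) by (apply sqrt_lt_R0; lra).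
  assert (b0 : 0 < sqrt B) by (apply sqrt_lt_R0; lra).
  assert (am : sqrt A < sqrt m) by (apply sqrt_lt_1_alt; lra).
  assert (mb : sqrt m <= sqrt B) by (apply sqrt_le_1_alt; lra).
  assert (bm : sqrt B <= sqrt (3 * m)) by (apply sqrt_le_1_alt; lra).
  apply Rle_trans with (2 * (ln (sqrt A + sqrt B) - ln (sqrt A)) / sqrt B);
    [|apply half_turn_ge_ln; lra].
  assert (l1 : ln (sqrt m) <= ln (sqrt A + sqrt B)) by (apply ln_le; lra).
  assert (l2 : ln (sqrt A) < ln (sqrt m)) by (apply ln_increasing; lra).
  assert (i : / sqrt (3 * m) <= / sqrt B) by (apply Rinv_le_contravar; lra).
  assert (0 < / sqrt (3 * m)) by (apply Rinv_0_lt_compat; lra).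
  unfold Rdiv. rewrite !Rmult_assoc, (Rmult_comm _ (/ sqrt B)).
  apply Rmult_le_compat_l; [lra|]. apply Rmult_le_compat; lra.
Qed.

Lemma period_limit_0 (k m : R) (hk : 0 < k) (hm : 0 < m) :
  is_lim (period k m) 0 p_infty.
Proof.
  apply is_lim_spec; intros M.
  assert (h2 : 0 < sqrt 2) by (apply sqrt_lt_R0; lra).
  assert (h3 : 0 < sqrt (3 * m)) by (apply sqrt_lt_R0; lra).
  assert (hk2 : 0 < sqrt 2 / k) by now apply Rdiv_lt_0_compat.
  set (c := sqrt 2 / k * (2 / sqrt (3 * m))).
  assert (hc : 0 < c) by (apply Rmult_lt_0_compat; [|apply Rdiv_lt_0_compat]; lra).
  (* Once [A < exp L ^ 2], [ln (sqrt A) < L], and the logarithmic lower bound exceeds [Rabs M]. *)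
  set (L := ln (sqrt m) - Rabs M / c - 1).
  assert (big : forall A B, 0 < A < Rmin (m / 2) (exp L ^ 2) -> m <= B <= 3 * m ->
                       Rabs M < sqrt 2 / k * half_turn A B).
  { intros A B hA hB.
    pose proof (Rmin_l (m / 2) (exp L ^ 2)). pose proof (Rmin_r (m / 2) (exp L ^ 2)).
    pose proof (exp_pos L).
    assert (hl : ln (sqrt A) < L).
    { rewrite <- (ln_exp L). apply ln_increasing; [apply sqrt_lt_R0; lra|].
      rewrite <- (sqrt_pow2 (exp L)) by lra. apply sqrt_lt_1_alt; lra. }
    apply Rlt_le_trans with (c * (ln (sqrt m) - ln (sqrt A))).
    - apply Rle_lt_trans with (c * (Rabs M / c)); [right; field; lra|].
      apply Rmult_lt_compat_l; [exact hc|]. unfold L in hl; lra.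
    - unfold c. rewrite Rmult_assoc. apply Rmult_le_compat_l; [lra|].
      apply half_turn_ge_ln_bounded; lra. }
  assert (he : 0 < Rmin (m / 2) (exp L ^ 2)).
  { apply Rmin_pos; [lra|]. apply pow_lt, exp_pos. }
  assert (hd := sqrt_disc_continuous m 0).
  replace (m ^ 2 + 4 * 0) with (m ^ 2) in hd by ring. rewrite sqrt_pow2 in hd by lra.
  destruct (proj1 (filterlim_locally _ _) hd (mkposreal _ he)) as [d1 hd1].
  (* [d1] brings [D] close to [m], while [m^2 / 4] keeps [E] above the bottom energy. *)
  assert (hd2 : 0 < Rmin d1 (m ^ 2 / 4)).
  { apply Rmin_pos; [apply cond_pos|nra]. }
  exists (mkposreal _ hd2). intros E hE hE0. simpl in hE.
  assert (hE1 : Rabs E < Rmin d1 (m ^ 2 / 4)).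
  { rewrite <- (Rminus_0_r E). exact hE. }
  pose proof (Rmin_l d1 (m ^ 2 / 4)). pose proof (Rmin_r d1 (m ^ 2 / 4)).
  assert (hE2 : Rabs E < d1) by lra. assert (hE3 : Rabs E < m ^ 2 / 4) by lra.
  apply Rabs_lt_between in hE3.
  assert (hDm : Rabs (sqrt (m ^ 2 + 4 * E) - m) < Rmin (m / 2) (exp L ^ 2)).
  { apply (hd1 E). change (Rabs (E - 0) < d1). now rewrite Rminus_0_r. }
  apply Rabs_lt_between in hDm.
  pose proof (Rmin_l (m / 2) (exp L ^ 2)).
  pose proof (RRle_abs M).
  destruct (Rtotal_order E 0) as [h|[h|h]]; [|lra|].
  - rewrite period_neg by exact h.
    pose proof (sqrt_disc_neg m E hm).
    eapply Rle_lt_trans; [eassumption|]. apply big; lra.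
  - rewrite period_pos by exact h.
    pose proof (sqrt_disc_pos m E hm h).
    assert (b : Rabs M < sqrt 2 / k * half_turn (sqrt (m ^ 2 + 4 * E) - m) (sqrt (m ^ 2 + 4 * E) + m))
      by (apply big; lra).
    pose proof (Rabs_pos M). lra.
Qed.

(** From [4 |E| = m^2 - D^2 = (m - D) (m + D)]. The quotient is [A / (A + B)] for [A = m - D] and
    [B = 2D], the form that the substitution for negative energy expects. *)
Lemma delta_spec (k : nat) (P E : R) (hP : INR k ^ 2 < P)
  (hE : - ((P - INR k ^ 2) ^ 2 / 4) < E < 0) :
  0 < delta k P E < 1 /\
  delta k P E ^ 2 = (P - INR k ^ 2 - sqrt ((P - INR k ^ 2) ^ 2 + 4 * E))
                    / (P - INR k ^ 2 + sqrt ((P - INR k ^ 2) ^ 2 + 4 * E)).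
Proof.
  unfold delta. set (m := P - INR k ^ 2) in *.
  assert (hm : 0 < m) by (unfold m; lra).
  pose proof (sqrt_disc_neg m E hm hE) as hD.
  assert (eD : sqrt (m ^ 2 + 4 * E) ^ 2 = m ^ 2 + 4 * E) by (apply sqrt_sq; lra).
  set (D := sqrt (m ^ 2 + 4 * E)) in *.
  rewrite Rabs_left by lra.
  assert (hs : 0 < sqrt (- E)) by (apply sqrt_lt_R0; lra).
  assert (es : sqrt (- E) ^ 2 = - E) by (apply sqrt_sq; lra).
  set (r := sqrt (- E)) in *.
  assert (h0 : 0 < (m - D) / (2 * r)) by (apply Rdiv_lt_0_compat; lra).
  assert (e : ((m - D) / (2 * r)) ^ 2 = (m - D) / (m + D)).
  { transitivity ((m - D) ^ 2 / (4 * r ^ 2)); [field; lra|].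
    rewrite es. replace (4 * - E) with ((m - D) * (m + D)) by lra. field; lra. }
  repeat split; [exact h0| |exact e].
  assert ((m - D) / (m + D) < 1); [|nra].
  apply (Rmult_lt_reg_r (m + D)); [lra|].
  replace ((m - D) / (m + D) * (m + D)) with (m - D) by (field; lra). lra.
Qed.

Theorem theorem2 (k : nat) (P : R) (hk : (1 <= k)%nat) (hP : INR k ^ 2 < P) :
  exists T : R -> R,
    (forall (alpha beta : R) (Theta : R -> R),
        is_solution k P alpha beta Theta ->
        (- ((P - INR k ^ 2) ^ 2 / 4) < energy k P alpha beta < 0
         \/ 0 < energy k P alpha beta) ->
        is_smallest_period Theta (T (energy k P alpha beta)))
    /\
    (forall E : R, 0 < E ->
        ex_RInt_gen (integrand_pos k P E) (at_point 0) (at_left 1) /\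
        T E = 4 * sqrt 2 / INR k ^ 2
              * RInt_gen (integrand_pos k P E) (at_point 0) (at_left 1))
    /\
    (forall E : R, - ((P - INR k ^ 2) ^ 2 / 4) < E < 0 ->
        0 < delta k P E < 1 /\
        ex_RInt_gen (integrand_neg k P E) (at_right (delta k P E)) (at_left 1) /\
        T E = 2 * sqrt 2
              / (INR k * sqrt (P - INR k ^ 2
                               + sqrt ((P - INR k ^ 2) ^ 2 + 4 * E)))
              * RInt_gen (integrand_neg k P E)
                         (at_right (delta k P E)) (at_left 1))
    /\
    filterlim T (at_right (- ((P - INR k ^ 2) ^ 2 / 4)))
      (locally (PI * sqrt 2 / (INR k * sqrt (P - INR k ^ 2))))
    /\
    is_lim T 0 p_infty
    /\
    is_lim T p_infty 0
    /\
    (forall E1 E2 : R,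
        - ((P - INR k ^ 2) ^ 2 / 4) < E1 -> E1 < E2 -> E2 < 0 -> T E1 < T E2)
    /\
    (forall E1 E2 : R, 0 < E1 -> E1 < E2 -> T E2 < T E1).
Proof.
  assert (hk0 : 0 < INR k) by (apply (lt_INR 0); exact hk).
  assert (hm : 0 < P - INR k ^ 2) by lra.
  exists (period (INR k) (P - INR k ^ 2)).
  split; [|split; [|split; [|split; [|split; [|split; [|split]]]]]].
  - intros alpha beta Theta [d1 [d2 [eq [e0 e1]]]] hE.
    apply period_smallest with (Derive Theta); auto.
    + split; intros t.
      * apply Derive_correct, d1.
      * replace (INR k ^ 2 * (P - INR k ^ 2) * Theta t - INR k ^ 4 * Theta t ^ 3)
          with (Derive (Derive Theta) t) by (specialize (eq t); lra).
        apply Derive_correct, d2.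
    + rewrite e0, e1. unfold energy. field.
  - intros E hE.
    assert (I : is_RInt_gen (integrand_pos k P E) (at_point 0) (at_left 1)
      (INR k * half_turn (sqrt ((P - INR k ^ 2) ^ 2 + 4 * E) - (P - INR k ^ 2))
                         (sqrt ((P - INR k ^ 2) ^ 2 + 4 * E) + (P - INR k ^ 2)) / 2)).
    (* [Lambda2] and [Lambda1] are [A / k^2] and [B / k^2] for [A = D - m] and [B = D + m]. *)
    { pose proof (sqrt_disc_pos _ E hm hE).
      unfold integrand_pos, Lambda1, Lambda2.
      replace ((INR k ^ 2 - P) ^ 2) with ((P - INR k ^ 2) ^ 2) by ring.
      set (D := sqrt ((P - INR k ^ 2) ^ 2 + 4 * E)) in *.
      replace (D - P + INR k ^ 2) with (D - (P - INR k ^ 2)) by ring.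
      replace (D + P - INR k ^ 2) with (D + (P - INR k ^ 2)) by ring.
      apply is_RInt_gen_legendre_pos; lra. }
    split; [eexists; exact I|].
    rewrite (is_RInt_gen_unique _ _ I), period_pos by exact hE.
    field; lra.
  - intros E hE. destruct (delta_spec k P E hP hE) as [hd ed].
    split; [exact hd|].
    pose proof (sqrt_disc_neg _ E hm hE).
    rewrite period_neg by lra.
    set (D := sqrt ((P - INR k ^ 2) ^ 2 + 4 * E)) in *.
    set (m := P - INR k ^ 2) in *.
    assert (I : is_RInt_gen (integrand_neg k P E) (at_right (delta k P E)) (at_left 1)
                  (sqrt (m + D) * half_turn (m - D) (2 * D) / 2)).
    { replace (m + D) with (m - D + 2 * D) by ring.
      apply is_RInt_gen_legendre_neg; try lra.
      rewrite ed. f_equal; ring. }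
    split; [eexists; exact I|].
    rewrite (is_RInt_gen_unique _ _ I).
    assert (0 < sqrt (m + D)) by (apply sqrt_lt_R0; lra).
    field; lra.
  - now apply period_limit_bottom.
  - now apply period_limit_0.
  - now apply period_limit_top.
  - intros; now apply period_increasing.
  - intros; now apply period_decreasing.
Qed.
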